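(* Let $\tau>0$, $a>0$, and let $s,d$ be integers with $1\le s<d/2$. The estimator $\hat\sigma^2=\frac1d\sum_{k=1}^{d-s}Y^2_{(k)}$ satisfies $$\sup_{P_\xi\in\mathcal G_{a,\tau}}\sup_{\sigma>0}\sup_{\theta\in\Theta_s}\frac{\mathbf E_{\theta,P_\xi,\sigma}(\hat\sigma^2-\sigma^2)^2}{\sigma^4}\le C\max\Big(\frac1{\sqrt d},\frac sd\log^{2/a}\Big(\frac{ed}{s}\Big)\Big)^2,$$ where $C>0$ depends only on $a$ and $\tau$.
   Context: Model: $Y_i=\theta_i+\sigma\xi_i$, $i=1,\dots,d$, $\theta\in\mathbb R^d$, $\sigma>0$, $\xi_i$ i.i.d. with distribution $P_\xi$, $\mathbf E\xi_1=0,\mathbf E\xi_1^2=1$; $\mathbf E_{\theta,P_\xi,\sigma}$ expectation; $\Theta_s=\{\theta:\|\theta\|_0\le s\}$. $\mathcal G_{a,\tau}$: distributions with $\mathbf E\xi_1=0,\mathbf E\xi_1^2=1$, $\mathbf P(|\xi_1|>t)\le2e^{-(t/\tau)^a}$ for all $t\ge2$. $Y^2_{(1)}\le\dots\le Y^2_{(d)}$ are the ordered values of $Y_1^2,\dots,Y_d^2$. *)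

(* Defs.v *)
From HB Require Import structures.
From mathcomp Require Import all_boot all_order all_algebra.
From mathcomp Require Import all_classical all_reals all_analysis.
Set Implicit Arguments. Unset Strict Implicit. Unset Printing Implicit Defensive.
Import Order.TTheory GRing.Theory Num.Theory.
Local Open Scope ring_scope.
Local Open Scope classical_set_scope.

Definition in_G {R : realType} (a tau : R) (mu : probability (measurableTypeR R) R) : Prop :=
  [/\ (\int[mu]_x (x%:E) = 0)%E,
      (\int[mu]_x ((x ^+ 2)%:E) = 1)%E &
      forall t : R, 2 <= t ->
        (mu [set x : R | (t < `|x|)%R] <= (2 * expR (- ((t / tau) `^ a)))%:E)%E].

Definition iid_with_law {R : realType} {dT : measure_display} {T : measurableType dT}
  (P : probability T R) (d : nat) (xi : 'I_d -> T -> R)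
  (mu : probability (measurableTypeR R) R) : Prop :=
  [/\ forall i, measurable_fun setT (xi i),
      forall i (B : set R), measurable B -> P (xi i @^-1` B) = mu B &
      forall B : 'I_d -> set R, (forall i, measurable (B i)) ->
        P (\bigcap_(i in [set: 'I_d]) (xi i @^-1` B i)) =
        (\prod_(i < d) P (xi i @^-1` B i))%E].

Definition sparse {R : realType} (d s : nat) (theta : 'I_d -> R) : Prop :=
  (#|[set i | theta i != 0%R]| <= s)%N.

Definition sigma_hat2 {R : realType} (d s : nat) (Y : 'I_d -> R) : R :=
  (d%:R)^-1 * \sum_(y <- take (d - s) (sort <=%R [seq Y i ^+ 2 | i <- enum 'I_d])) y.

Definition rate {R : realType} (a : R) (d s : nat) : R :=
  Num.max (Num.sqrt (d%:R))^-1
          (s%:R / d%:R * (ln (expR 1 * d%:R / s%:R)) `^ (2 / a)).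

(* Main.v *)
Require Import Defs.
From HB Require Import structures.
From mathcomp Require Import all_boot all_order all_algebra.
From mathcomp Require Import all_classical all_reals all_analysis.
From mathcomp Require Import measurable_realfun ring lra.
Set Implicit Arguments. Unset Strict Implicit. Unset Printing Implicit Defensive.
Import Order.TTheory GRing.Theory Num.Theory.
Local Open Scope ring_scope.

(* After rescaling to sigma = 1, comparing the trimmed sum with the sum over
   the complement of the support of theta gives
   S - R <= d sigma_hat2 <= S, where S is the sum of the xi_i^2 and R the sum of
   the 2s largest ones. For every t, R <= 2 s t^2 + Z with Z the sum of the
   xi_i^2 exceeding t^2. The fluctuation E (S - d)^2 is at most d E xi^4, and
   with t of order log^(1/a)(e d / s) the tail bound makes
   E xi^2 1(|xi| > t) at most of order s / d, so that E Z^2 is of order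
   d + s^2. *)

(** * Order statistics and a pointwise bound on the error *)

(** Sorting the indices by their values, rather than the values themselves, settles ties and makes
    the kept terms an index set of size exactly [m]. The threshold [c] is the next value in the
    order, which exists because [m < d]; being one of the [y i], it inherits their sign. *)
Lemma trimmed_setE (R : realDomainType) (d m : nat) (y : 'I_d -> R) :
  (m < d)%N ->
  exists (A : {set 'I_d}) (c : R),
    [/\ #|A| = m,
        \sum_(z <- take m (sort <=%R [seq y i | i <- enum 'I_d])) z =
          \sum_(i in A) y i,
        exists i, c = y i,
        forall i, i \in A -> y i <= c & forall i, i \notin A -> c <= y i].
Proof.
move=> md.
pose r : rel 'I_d := relpre y <=%R.
pose e := sort r (enum 'I_d).
have pe : perm_eq e (enum 'I_d) by rewrite perm_sort.
have ue : uniq e by rewrite (perm_uniq pe) enum_uniq.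
have se : size e = d by rewrite (perm_size pe) size_enum_ord.
have he : sorted r e by apply: sort_sorted => i j; exact: le_total.
have tr : transitive r by move=> i j k; exact: le_trans.
have i0 : 'I_d by exact: (Ordinal md).
have catE := cat_take_drop m e.
have lastE : drop m e = nth i0 e m :: drop m.+1 e by rewrite -drop_nth ?se.
have hp : pairwise r (take m e ++ drop m e).
  by rewrite catE -(sorted_pairwise tr).
exists [set i in take m e], (y (nth i0 e m)); split.
- by rewrite cardsE (card_uniqP (take_uniq m ue)) size_take se md.
- rewrite sort_map -map_take big_map -/e.
  rewrite big_uniq ?take_uniq//.
  by apply: eq_bigl => i; rewrite inE.
- by exists (nth i0 e m).
- move=> i; rewrite inE => ie.
  move: hp; rewrite pairwise_cat => /and3P[/allrelP h _ _].
  by apply: h => //; rewrite lastE mem_head.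
- move=> i; rewrite inE => ie.
  have : i \in take m e ++ drop m e by rewrite catE (perm_mem pe) mem_enum.
  rewrite mem_cat (negPf ie) /= lastE in_cons => /predU1P[->//|id].
  move: hp; rewrite pairwise_cat => /and3P[_ _].
  by rewrite lastE /= => /andP[/allP h _]; exact: h.
Qed.

(** After subtracting [c], the terms indexed by [A] are nonpositive and all others nonnegative, so
    [A] minimises the shifted sum over all index sets. Undoing the shift costs [c] times the excess
    of [#|B|] over [m], which has the right sign since [c] is nonnegative. *)
Lemma trimmed_sum_le (R : realDomainType) (d m : nat) (y : 'I_d -> R)
    (B : {set 'I_d}) :
  (m < d)%N -> (forall i, 0 <= y i) -> (m <= #|B|)%N ->
  \sum_(z <- take m (sort <=%R [seq y i | i <- enum 'I_d])) z
    <= \sum_(i in B) y i.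
Proof.
move=> md y0 mB; have [A [c [cA -> [j cj] Ac nAc]]] := trimmed_setE y md.
have c0 : 0 <= c by rewrite cj.
have h : \sum_(i in A) (y i - c) <= \sum_(i in B) (y i - c).
  rewrite big_mkcond [leRHS]big_mkcond; apply: ler_sum => i _.
  have := Ac i; have := nAc i; case: (i \in A); case: (i \in B) => //= h1 h2.
    by rewrite subr_le0 h2.
  by rewrite subr_ge0 h1.
have : \sum_(i in A) y i - c * m%:R <= \sum_(i in B) y i - c * #|B|%:R.
  by move: h; rewrite !sumrB !sumr_const cA !mulr_natr.
have : c * m%:R <= c * #|B|%:R by rewrite ler_wpM2l// ler_nat.
lra.
Qed.

(** A counting argument: an index that is kept and lies outside [S] has its [x i] in the trimmed
    sum. Each of the at most [s + (d - m)] other indices contributes at most [b], or else appears in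
    the last sum. *)
Lemma trimmed_sum_ge (R : realDomainType) (d m s : nat) (x y : 'I_d -> R)
    (S : {set 'I_d}) (b : R) :
  (m < d)%N -> (forall i, 0 <= y i) -> 0 <= b ->
  (forall i, i \notin S -> y i = x i) -> (#|S| <= s)%N -> 
  \sum_i x i <= \sum_(z <- take m (sort <=%R [seq y i | i <- enum 'I_d])) z
    + b * (s + (d - m))%:R + \sum_i (if b < x i then x i else 0).
Proof.
move=> md y0 b0 yx Ss; have [A [c [cA -> _ _ _]]] := trimmed_setE y md.
have cAC : #|~: A| = (d - m)%N by rewrite cardsCs finset.setCK card_ord cA.
have h : \sum_i x i <= \sum_i ((if i \in A then y i else 0) +
    ((if i \in S then b else 0) + (if i \in ~: A then b else 0))
    + (if b < x i then x i else 0)).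
  apply: ler_sum => i _; rewrite inE.
  have := yx i; have := y0 i; case: (i \in A); case: (i \in S) => //=;
    case: ltP => //= h1 h2 h3; try lra; have := h3 isT; lra.
apply: (le_trans h); rewrite !big_split /= -!big_mkcond /= !sumr_const cAC.
rewrite natrD mulrDr !lerD2r !lerD2l -!(mulr_natr b) lerD//.
by rewrite ler_wpM2l ?ler_nat.
Qed.

Lemma sigma_hat2_error_le (R : realType) (d s : nat) (theta z : 'I_d -> R)
    (sigma t : R) :
  (0 < s)%N -> (s < d)%N -> 0 < sigma -> sparse s theta ->
  (sigma_hat2 s (fun i => theta i + sigma * z i) - sigma ^+ 2) ^+ 2 / sigma ^+ 4
    <= d%:R ^- 2 * (2 * (\sum_i z i ^+ 2 - d%:R) ^+ 2
         + 16 * (s%:R * t ^+ 2) ^+ 2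
         + 4 * (\sum_i if t ^+ 2 < z i ^+ 2 then z i ^+ 2 else 0) ^+ 2).
Proof.
move=> s0 sd sigma0 sp.
pose y i := (theta i + sigma * z i) ^+ 2; pose x i := (sigma * z i) ^+ 2.
pose S := finset (fun i => theta i != 0).
have cS : (#|S| <= s)%N.
  apply: leq_trans sp; apply/subset_leq_card/fintype.subsetP => i.
  by rewrite finset.in_set => i0; exact/mem_set.
have yx i : i \notin S -> y i = x i.
  by rewrite finset.in_set negbK /y => /eqP ->; rewrite add0r.
have md : (d - s < d)%N by rewrite ltn_subrL s0 (leq_ltn_trans _ sd).
have y0 i : 0 <= y i by exact: sqr_ge0.
have x0 i : 0 <= x i by exact: sqr_ge0.
have cSC : (d - s <= #|~: S|)%N.
  by rewrite cardsCs finset.setCK card_ord leq_sub2l.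
have sg2 : 0 < sigma ^+ 2 by rewrite exprn_gt0.
have xE : \sum_i x i = sigma ^+ 2 * \sum_i z i ^+ 2.
  by rewrite mulr_sumr; apply: eq_bigr => i _; rewrite /x exprMn.
have ZE : \sum_i (if (sigma * t) ^+ 2 < x i then x i else 0) =
    sigma ^+ 2 * \sum_i if t ^+ 2 < z i ^+ 2 then z i ^+ 2 else 0.
  rewrite mulr_sumr; apply: eq_bigr => i _; rewrite /x !exprMn ltr_pM2l//.
  by case: ifP; rewrite ?mulr0.
have := trimmed_sum_ge md y0 (sqr_ge0 (sigma * t)) yx cS.
have : \sum_(w <- take (d - s) (sort <=%R [seq y i | i <- enum 'I_d])) w
    <= \sum_i x i.
  apply: (le_trans (trimmed_sum_le md y0 cSC)).
  rewrite big_mkcond; apply: ler_sum => i _.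
  by case: ifPn => // iS; rewrite yx// -finset.in_setC.
(* Since [d - (d - s) = s], the support of [theta] and the discarded indices each contribute [s]
   terms, whence the factor 2 in [2 * p] below. *)
rewrite xE ZE subKn ?(ltnW sd)// natrD /sigma_hat2 -/y.
set Q := \sum_(w <- _) w; set Z := \sum_i (if _ then _ else _).
set X := \sum_i _.
have Z0 : 0 <= Z by apply: sumr_ge0 => i _; case: ifP => // _; exact: sqr_ge0.
pose q := Q / sigma ^+ 2.
have -> : Q = sigma ^+ 2 * q by rewrite /q mulrC divfK ?gt_eqF.
move=> U L; have {U}qX : q <= X by rewrite ler_pM2l in U.
have {L}Xq : X <= q + t ^+ 2 * (s%:R + s%:R) + Z.
  by rewrite -(ler_pM2l sg2); apply: (le_trans L); rewrite le_eqVlt;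
    apply/orP; left; apply/eqP; ring.
have dn0 : d%:R != 0 :> R by rewrite pnatr_eq0 -lt0n (leq_ltn_trans _ sd).
have -> : (d%:R^-1 * (sigma ^+ 2 * q) - sigma ^+ 2) ^+ 2 / sigma ^+ 4 =
    d%:R ^- 2 * (q - d%:R) ^+ 2.
  by field; rewrite dn0 gt_eqF.
rewrite ler_wpM2l ?invr_ge0 ?exprn_ge0//.
set p := s%:R * t ^+ 2; set n := d%:R.
have p0 : 0 <= p by rewrite mulr_ge0 ?sqr_ge0.
have {}Xq : X - q <= 2 * p + Z by move: Xq; rewrite /p; lra.
have r0 : 0 <= X - q by rewrite subr_ge0.
have rr : (X - q) ^+ 2 <= (2 * p + Z) ^+ 2.
  by rewrite lerXn2r ?nnegrE// (le_trans r0).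
(* These squares give [(q - n)^2 <= 2 (X - n)^2 + 2 (X - q)^2] and [(2 p + Z)^2 <= 8 p^2 + 2 Z^2],
   which together produce the constants 2, 16 and 4. *)
have := sqr_ge0 (2 * p - Z); have := sqr_ge0 ((X - n) + (X - q)).
nra.
Qed.

(** * Integrals under independence and second moments of sums *)

Local Open Scope classical_set_scope.

(* Without measurability, unlike [ge0_le_integral]: this dispenses with the
   measurability of the order statistics. *)
Lemma nneg_le_integral (R : realType) (dT : measure_display)
    (T : measurableType dT) (mu : {measure set T -> \bar R}) (f g : T -> \bar R) :
  (forall x, 0 <= f x)%E -> (forall x, f x <= g x)%E ->
  (\int[mu]_x f x <= \int[mu]_x g x)%E.
Proof.
move=> f0 fg; have g0 x : (0 <= g x)%E by exact: le_trans (f0 x) (fg x).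
rewrite !ge0_integralTE//; apply: le_ereal_sup => _ [h hf <-].
by exists h => // x; exact: le_trans (hf x) (fg x).
Qed.

(** The product rule on rectangles identifies the joint law of [X] and [Y] with the product measure,
    by uniqueness of the latter; Tonelli then separates the factors. Nonnegativity of [f] and [g]
    replaces any integrability condition. *)
Lemma ge0_integral_mul_indep (R : realType) (d d1 d2 : measure_display)
    (T : measurableType d) (T1 : measurableType d1) (T2 : measurableType d2)
    (P : {measure set T -> \bar R})
    (mu : {sigma_finite_measure set T1 -> \bar R})
    (nu : {sigma_finite_measure set T2 -> \bar R})
    (X : T -> T1) (Y : T -> T2) (f : T1 -> \bar R) (g : T2 -> \bar R) :
  measurable_fun setT X -> measurable_fun setT Y ->
  (forall A B, measurable A -> measurable B ->
    P (X @^-1` A `&` Y @^-1` B) = (mu A * nu B)%E) ->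
  measurable_fun setT f -> measurable_fun setT g ->
  (forall x, 0 <= f x)%E -> (forall x, 0 <= g x)%E ->
  (\int[P]_w (f (X w) * g (Y w)) =
   (\int[mu]_x f x) * (\int[nu]_x g x))%E.
Proof.
move=> mX mY indep mf mg f0 g0.
pose XY w := (X w, Y w).
have mXY : measurable_fun setT XY by exact: measurable_fun_pair.
pose h z := (f z.1 * g z.2)%E.
have mh : measurable_fun setT h.
  by apply: emeasurable_funM;
    [exact: (measurableT_comp mf)|exact: (measurableT_comp mg)].
have h0 z : (0 <= h z)%E by rewrite mule_ge0.
transitivity (\int[pushforward P XY]_z h z)%E.
  by rewrite [RHS]ge0_integral_pushforward.
pose HB := isMeasurableFun.Build _ _ _ _ _ mXY.
pose XYm : {mfun T >-> (T1 * T2)%type} := HB.pack XY HB.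
rewrite (eq_measure_integral (mu \x nu)%E); last first.
  move=> A mA _; symmetry.
  apply: (product_measure_unique (m' := pushforward P XYm)) => //.
rewrite fubini_tonelli1//= /fubini_F.
under eq_integral => x _ do rewrite /h /= ge0_integralZl//.
by rewrite ge0_integralZr//; exact: integral_ge0.
Qed.

Lemma ge0_integral_law (R : realType) (d d1 : measure_display)
    (T : measurableType d) (T1 : measurableType d1)
    (P : {measure set T -> \bar R}) (mu : {measure set T1 -> \bar R})
    (X : T -> T1) (f : T1 -> \bar R) :
  measurable_fun setT X ->
  (forall A, measurable A -> P (X @^-1` A) = mu A) ->
  measurable_fun setT f -> (forall x, 0 <= f x)%E ->
  (\int[P]_w f (X w) = \int[mu]_x f x)%E.
Proof.
move=> mX law mf f0.
transitivity (\int[pushforward P X]_x f x)%E.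
  by rewrite [RHS]ge0_integral_pushforward.
pose mXfact := isMeasurableFun.Build _ _ _ _ _ mX.
pose Xm : {mfun T >-> T1} := HB.pack X mXfact.
apply: (eq_measure_integral mu (m1 := pushforward P Xm)) => A mA _.
exact: law.
Qed.

(** Pairwise independence follows from the product rule for all [d] coordinates by taking the whole
    line at every index other than [i] and [j]. *)
Lemma iid_with_law_pair (R : realType) (dT : measure_display)
    (T : measurableType dT) (P : probability T R) (d : nat)
    (xi : 'I_d -> T -> R) (mu : probability (measurableTypeR R) R) (i j : 'I_d)
    (A B : set R) :
  iid_with_law P xi mu -> i != j -> measurable A -> measurable B ->
  P (xi i @^-1` A `&` xi j @^-1` B) = (mu A * mu B)%E.
Proof.
move=> [_ law indep] ij mA mB.
pose C k := if k == i then A else if k == j then B else setT.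
have mC k : measurable (C k) by rewrite /C; case: ifP => // _; case: ifP.
have ji : (j == i) = false by rewrite eq_sym (negPf ij).
have -> : xi i @^-1` A `&` xi j @^-1` B =
    \bigcap_(k in [set: 'I_d]) (xi k @^-1` C k).
  apply/seteqP; split => [w [wA wB] k _|w h].
    by rewrite /C /=; case: eqP => [->//|_]; case: eqP => [->|].
  have := h i I; have := h j I; rewrite /C /= ji !eqxx => wB wA.
  by split.
rewrite indep// (bigD1 i)//= (bigD1 j)/=; last by rewrite ji.
rewrite big1 ?mule1 => [|k /andP[ki kj]].
  by rewrite !law// /C ji !eqxx.
by rewrite /C (negPf ki) (negPf kj) preimage_setT probability_setT.
Qed.

(** The square is expanded into a double sum: independence bounds the off-diagonal terms by
    [m1 ^+ 2], and identical distribution bounds the [d] diagonal ones by [m2]. *)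
Lemma iid_sum_sqr_le (R : realType) (dT : measure_display)
    (T : measurableType dT) (P : probability T R) (d : nat)
    (xi : 'I_d -> T -> R) (mu : probability (measurableTypeR R) R)
    (f : R -> R) (m1 m2 : R) :
  iid_with_law P xi mu ->
  measurable_fun setT f -> (forall x, 0 <= f x) -> 0 <= m1 ->
  (\int[mu]_x (f x)%:E <= m1%:E)%E ->
  (\int[mu]_x (f x ^+ 2)%:E <= m2%:E)%E ->
  (\int[P]_w ((\sum_i f (xi i w)) ^+ 2)%:E
     <= (d%:R * m2 + d%:R ^+ 2 * m1 ^+ 2)%:E)%E.
Proof.
move=> iid mf f0 m10 fm1 fm2; have [mxi law _] := iid.
have mEf : measurable_fun [set: measurableTypeR R] (EFin \o f).
  exact/measurable_EFinP.
have mfxi i : measurable_fun setT (fun w => f (xi i w)).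
  exact: (measurableT_comp mf (mxi i)).
(* The diagonal is charged [m1 ^+ 2] as well, so that the double sum evaluates directly to
   [d m2 + d^2 m1^2]. *)
have pair i j : (\int[P]_w (f (xi i w) * f (xi j w))%:E <=
    (m1 ^+ 2 + if j == i then m2 else 0)%:E)%E.
  have [<-|ij] := eqVneq i j.
    rewrite EFinD (ge0_integral_law (T1 := measurableTypeR R) (mu := mu)
      (f := fun x => (f x * f x)%:E) (mxi i) (law i)); last 2 first.
    - by apply/measurable_EFinP; exact: measurable_funM.
    - by move=> x; rewrite lee_fin mulr_ge0.
    by apply: (le_trans fm2); rewrite leeDr// lee_fin sqr_ge0.
  under eq_integral do rewrite EFinM.
  rewrite addr0 (ge0_integral_mul_indep (T1 := measurableTypeR R)
    (T2 := measurableTypeR R) (mu := mu) (nu := mu)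
    (f := EFin \o f) (g := EFin \o f) (mxi i) (mxi j))//=.
  - rewrite expr2 EFinM lee_pmul//; apply: integral_ge0 => x _;
      by rewrite lee_fin.
  - by move=> A B; exact: iid_with_law_pair.
under eq_integral.
  move=> w _; rewrite expr2 mulr_suml -sumEFin.
  under eq_bigr do rewrite mulr_sumr -sumEFin.
  over.
rewrite ge0_integral_sum//; first last.
- by move=> i w _; apply: sume_ge0 => j _; rewrite lee_fin mulr_ge0.
- move=> i; apply: emeasurable_sum => j; apply/measurable_EFinP.
  exact: measurable_funM.
apply: (@le_trans _ _ (\sum_(i < d) \sum_(j < d)
    (m1 ^+ 2 + if j == i then m2 else 0)%:E)%E).
  apply: lee_sum => i _; rewrite ge0_integral_sum//.
  - by apply: lee_sum => j _; exact: pair.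
  - by move=> j; apply/measurable_EFinP; exact: measurable_funM.
  - by move=> j w _; rewrite lee_fin mulr_ge0.
under eq_bigr do rewrite sumEFin.
rewrite sumEFin lee_fin.
under eq_bigr do
  rewrite big_split /= -big_mkcond /= big_pred1_eq sumr_const card_ord.
rewrite sumr_const card_ord -mulr_natl -(mulr_natl (m1 ^+ 2)).
lra.
Qed.

(** * Moments of the noise from its tail *)

Lemma measurable_norm_gt (R : realType) (t : R) :
  measurable ([set x : R | t < `|x|] : set (measurableTypeR R)).
Proof.
rewrite [X in measurable X](_ : _ =
    [set: R] `&` (fun x : R => `|x|) @^-1` `]t, +oo[).
  exact: normr_measurable.
by apply/seteqP; split => x /=; rewrite in_itv/= andbT// => -[].
Qed.

Lemma dyadic_ge (R : realType) (x : R) :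
  2 < x -> exists n : nat, 2 ^+ n.+1 < x <= 2 ^+ n.+2.
Proof.
move=> x2.
have ex : exists n : nat, x <= 2 ^+ n.+2.
  by exists (Num.bound x); rewrite ltW// upper_nthrootP// -addn2 leq_addr.
have [n xn nmin] := ex_minnP ex; exists n; rewrite xn andbT.
case: n xn nmin => [|n] _ nmin; first by rewrite expr1.
by rewrite ltNge; apply/negP => /nmin; rewrite ltnn.
Qed.

(* Exponential decay in a power of [u] beats [u ^- 5]: expand [expR] to an
   order [n >= 5 / a]. *)
Lemma expRN_powR_le (R : realType) (a tau : R) : 0 < a -> 0 < tau ->
  exists2 K : R, 0 < K & forall u, 0 < u ->
    u ^+ 5 * expR (- (u / tau) `^ a) <= K.
Proof.
move=> a0 tau0; pose n := Num.bound (5 / a).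
have n5 : 5 <= a * n%:R.
  by rewrite mulrC -ler_pdivrMr// ltW// archi_boundP// divr_ge0// ltW.
have n0 : (0 < n)%N.
  by rewrite lt0n; apply/eqP => n0; move: n5; rewrite n0 mulr0; lra.
(* The factor [tau ^+ 5] comes from [u = tau * w]. The other one bounds [w^5 exp(-v)], through
   [w^5 <= 1 + v^n] and [v^n <= n! exp(v)]; the summand 1 covers [w <= 1]. *)
exists (tau ^+ 5 * (1 + n`!%:R)).
  by rewrite mulr_gt0 ?exprn_gt0// ltr_pwDl// ler0n.
move=> u u0; set w := u / tau; set v := w `^ a.
have w0 : 0 < w by rewrite divr_gt0.
have v0 : 0 <= v by exact: powR_ge0.
have -> : u = tau * w by rewrite /w mulrC divfK ?gt_eqF.
have f0 : 0 < n`!%:R :> R by rewrite ltr0n fact_gt0.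
have f1 : 1 <= n`!%:R :> R by rewrite ler1n fact_gt0.
have expn : v ^+ n <= n`!%:R * expR v.
  rewrite -ler_pdivrMl// mulrC.
  have := expR_ge1Dxn n.-1 v0; rewrite (prednK n0); lra.
have exp1 : 1 <= expR v by have := expR_ge1Dx v; lra.
have w5 : w ^+ 5 <= 1 + v ^+ n.
  have [w1|w1] := leP w 1.
    have : w ^+ 5 <= 1 by rewrite exprn_ile1// ltW.
    have : 0 <= v ^+ n by rewrite exprn_ge0.
    lra.
  have : w ^+ 5 <= v ^+ n.
    rewrite -(powR_mulrn 5 (ltW w0)) -(powR_mulrn n v0) /v -powRrM.
    by apply: ler_powR => //; exact: ltW.
  lra.
rewrite expRN ler_pdivrMr ?expR_gt0// exprMn -[leRHS]mulrA.
rewrite ler_pM2l ?exprn_gt0//; nra.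
Qed.

(** Dyadic decomposition from 2 upwards, where the tail bound is available: [x^4] is at most 16 for
    [|x| <= 2], and at most [c i] on the shell [2^(i+1) < |x| <= 2^(i+2)]. The indicator of each
    shell is replaced by that of the tail [A i]. *)
Lemma in_G_fourth_moment (R : realType) (a tau : R) : 0 < a -> 0 < tau ->
  exists2 M : R, 0 < M &
  forall mu : probability (measurableTypeR R) R, in_G a tau mu ->
    (\int[mu]_x (x ^+ 4)%:E <= M%:E)%E.
Proof.
move=> a0 tau0; have [K K0 hK] := expRN_powR_le a0 tau0.
exists (16 + 32 * K); first by rewrite ltr_pwDl// mulr_ge0// ltW.
move=> mu [_ _ tail].
pose A i : set (measurableTypeR R) := [set x : R | 2 ^+ i.+1 < `|x|].
pose c i : R := (2 ^+ i.+2) ^+ 4.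
have mA i : measurable (A i) by exact: measurable_norm_gt.
have c0 i : 0 <= c i by rewrite !exprn_ge0.
pose g i (x : measurableTypeR R) := ((c i)%:E * (\1_(A i) x)%:E)%E.
have g0 i x : (0 <= g i x)%E by rewrite mule_ge0// lee_fin.
have mind i : measurable_fun [set: measurableTypeR R]
    (fun x => (\1_(A i) x)%:E : \bar R).
  by apply/measurable_EFinP; exact: measurable_indic.
have mg i : measurable_fun [set: measurableTypeR R] (g i).
  exact: measurable_funeM.
apply: (@le_trans _ _ (\int[mu]_x (16%:E + \sum_(i <oo) g i x))%E).
  apply: nneg_le_integral => x; first by rewrite lee_fin exprn_even_ge0.
  have x4 : x ^+ 4 = `|x| ^+ 4 by rewrite -normrX ger0_norm// exprn_even_ge0.
  have [x2|x2] := leP `|x| 2.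
    apply: (@le_trans _ _ 16%:E); last by rewrite leeDl// nneseries_ge0.
    by rewrite lee_fin x4 (_ : 16 = 2 ^+ 4) ?lerXn2r ?nnegrE//; ring.
  have [n /andP[n1 n2]] := dyadic_ge x2.
  apply: (@le_trans _ _ (g n x)).
    rewrite /g indicE mem_set//= mule1 lee_fin x4 /c lerXn2r ?nnegrE//.
  apply: (@le_trans _ _ (\sum_(i <oo) g i x)%E); last by rewrite leeDr.
  rewrite (nneseriesD1 (n := n))// leeDl// nneseries_ge0// => i _ _; exact: g0.
rewrite ge0_integralD//; first last.
- by apply: ge0_emeasurable_sum => // i x _ _; exact: g0.
- by move=> x _; apply: nneseries_ge0 => i _ _; exact: g0.
rewrite integral_cst//= probability_setT mule1 [leRHS]EFinD leeD//.
rewrite integral_nneseries//.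
(* With [u = 2^(i+1)], the term is at most [16 u^4] times [2 exp(-(u / tau)^a)]. The fifth power in
   [expRN_powR_le] leaves a spare factor [1 / u], which makes the series geometric. *)
apply: (@le_trans _ _ (\sum_(i <oo) ((32 * K) / (2 ^ i.+1)%:R)%:E)%E); last first.
  by apply: epsilon_trick0; rewrite mulr_ge0// ltW.
apply: lee_nneseries => i _; first by move=> _; apply: integral_ge0 => x _.
rewrite ge0_integralZl_EFin//.
rewrite integral_indic// setIT.
have t2 : (2 : R) <= 2 ^+ i.+1 by rewrite ler_eXnr// ler1n.
apply: (@le_trans _ _ ((c i)%:E * (2 * expR (- (2 ^+ i.+1 / tau) `^ a))%:E)%E).
  by rewrite lee_wpmul2l ?lee_fin//; exact: tail.
have u0 : 0 < (2 : R) ^+ i.+1 by rewrite exprn_gt0.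
rewrite -EFinM lee_fin /c natrX [2 ^+ i.+2]exprS.
have := hK _ u0; set u := (2 : R) ^+ i.+1 in u0 *; set e := expR _ => hu.
rewrite ler_pdivlMr//.
rewrite [leLHS](_ : _ = 32 * (u ^+ 5 * e)); last by ring.
by rewrite ler_pM2l.
Qed.

(** On the tail, [x^2 <= 2 x^2 <= eps x^4 + 1 / eps]. The first term integrates to at most [eps M],
    and the second to at most [2 eps] because the tail probability is at most [2 eps^2]. *)
Lemma in_G_truncated_moment (R : realType) (a tau M t eps : R)
    (mu : probability (measurableTypeR R) R) :
  in_G a tau mu -> (\int[mu]_x (x ^+ 4)%:E <= M%:E)%E -> 2 <= t -> 0 < eps ->
  expR (- (t / tau) `^ a) <= eps ^+ 2 ->
  (\int[mu]_x (if (t ^+ 2 < x ^+ 2)%R then x ^+ 2 else 0)%:E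
     <= (eps * (M + 2))%:E)%E.
Proof.
move=> [_ _ tail] M4 t2 eps0 teps.
have t0 : 0 <= t by lra.
pose A : set (measurableTypeR R) := [set x : R | t < `|x|].
have mA : measurable A by exact: measurable_norm_gt.
have mx4 : measurable_fun [set: measurableTypeR R] (fun x : R => (x ^+ 4)%:E).
  by apply/measurable_EFinP; exact: measurable_funX.
have mind : measurable_fun [set: measurableTypeR R]
    (fun x => (\1_A x)%:E : \bar R).
  by apply/measurable_EFinP; exact: measurable_indic.
apply: (@le_trans _ _ (\int[mu]_x (eps%:E * (x ^+ 4)%:E
    + (eps^-1)%:E * (\1_A x)%:E))%E).
  apply: nneg_le_integral => x.
    by rewrite lee_fin; case: ifP => // _; exact: sqr_ge0.
  rewrite -!EFinM -EFinD lee_fin.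
  have h4 : 0 <= x ^+ 4 by rewrite exprn_even_ge0.
  have i0 : 0 < eps^-1 by rewrite invr_gt0.
  case: ifPn => [tx|_]; last by rewrite addr_ge0// mulr_ge0// ltW.
  have Ax : A x.
    rewrite /A /=; move: tx; rewrite -[x ^+ 2]real_normK ?num_real//.
    by rewrite ltr_pXn2r// nnegrE.
  rewrite indicE mem_set//= mulr1.
  have : 0 <= eps * (x ^+ 2 - eps^-1) ^+ 2 by rewrite mulr_ge0 ?sqr_ge0// ltW.
  rewrite [X in 0 <= X -> _](_ : _ = eps * x ^+ 4 - 2 * x ^+ 2 + eps^-1);
    last by field; rewrite gt_eqF.
  have := sqr_ge0 x; lra.
rewrite ge0_integralD//; first last.
- exact: measurable_funeM.
- by move=> x _; rewrite mule_ge0// lee_fin// invr_ge0 ltW.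
- exact: measurable_funeM.
- by move=> x _; rewrite mule_ge0// lee_fin ?exprn_even_ge0// ltW.
rewrite !ge0_integralZl_EFin//; first last.
- by rewrite ltW.
- by move=> x _; rewrite lee_fin exprn_even_ge0.
- by rewrite invr_ge0 ltW.
rewrite integral_indic// setIT mulrDr EFinD.
apply: leeD; first by rewrite EFinM lee_wpmul2l// lee_fin ltW.
apply: (@le_trans _ _ ((eps^-1)%:E * (2 * expR (- (t / tau) `^ a))%:E)%E).
  by rewrite lee_wpmul2l ?lee_fin ?invr_ge0 ?(ltW eps0)//; exact: tail.
rewrite -EFinM lee_fin ler_pdivrMl//.
move: teps; set e := expR _; lra.
Qed.

(** Here the mean is exactly [m1], so the term [d^2 m1^2] of [iid_sum_sqr_le] cancels against the
    squared mean of the sum, leaving order [d]. *)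
Lemma iid_sum_variance_le (R : realType) (dT : measure_display)
    (T : measurableType dT) (P : probability T R) (d : nat)
    (xi : 'I_d -> T -> R) (mu : probability (measurableTypeR R) R)
    (f : R -> R) (m1 m2 : R) :
  iid_with_law P xi mu ->
  measurable_fun setT f -> (forall x, 0 <= f x) ->
  (\int[mu]_x (f x)%:E = m1%:E)%E ->
  (\int[mu]_x (f x ^+ 2)%:E <= m2%:E)%E ->
  (\int[P]_w ((\sum_i f (xi i w) - d%:R * m1) ^+ 2)%:E <= (d%:R * m2)%:E)%E.
Proof.
move=> iid mf f0 fm1 fm2; have [mxi law _] := iid.
have m10 : 0 <= m1.
  by rewrite -lee_fin -fm1; apply: integral_ge0 => x _; rewrite lee_fin.
have mfxi i : measurable_fun setT (fun w => f (xi i w)).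
  exact: (measurableT_comp mf (mxi i)).
pose S w := \sum_i f (xi i w); pose c := d%:R * m1.
have mS : measurable_fun setT S by exact: measurable_sum.
have S0 w : 0 <= S w by exact: sumr_ge0.
have c0 : 0 <= c by rewrite mulr_ge0.
have intS : (\int[P]_w (S w)%:E = c%:E)%E.
  under eq_integral do rewrite -sumEFin.
  rewrite ge0_integral_sum//; first last.
  - by move=> i w _; rewrite lee_fin.
  - by move=> i; exact/measurable_EFinP.
  transitivity (\sum_(i < d) m1%:E)%E; last first.
    by rewrite sumEFin sumr_const card_ord -mulr_natl.
  apply: eq_bigr => i _; rewrite -fm1.
  rewrite (ge0_integral_law (T1 := measurableTypeR R) (mu := mu)
    (f := EFin \o f) (mxi i) (law i))//.
  exact/measurable_EFinP.
(* Integrating [(S - c)^2 + 2 c S = S^2 + c^2], with the cross term on the left, involves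
   nonnegative integrands only. *)
have h : (\int[P]_w ((S w - c) ^+ 2)%:E + (2 * c * c)%:E <=
    (d%:R * m2 + c ^+ 2)%:E + (c ^+ 2)%:E)%E.
  have -> : (2 * c * c)%:E = (\int[P]_w ((2 * c)%:E * (S w)%:E))%E.
    rewrite ge0_integralZl_EFin//; first last.
    - by rewrite mulr_ge0.
    - exact/measurable_EFinP.
    - by move=> w _; rewrite lee_fin.
    by rewrite intS -EFinM.
  rewrite -ge0_integralD//; first last.
  - by apply: measurable_funeM; exact/measurable_EFinP.
  - by move=> w _; rewrite -EFinM lee_fin mulr_ge0// mulr_ge0.
  - apply/measurable_EFinP; apply: measurable_funX.
    exact: measurable_funB.
  - by move=> w _; rewrite lee_fin sqr_ge0.
  rewrite (eq_integral (fun w => (S w ^+ 2)%:E + (c ^+ 2)%:E)%E); last first.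
    by move=> w _; rewrite -EFinM -!EFinD; congr EFin; ring.
  rewrite ge0_integralD//; first last.
  - by move=> w _; rewrite lee_fin sqr_ge0.
  - by apply/measurable_EFinP; exact: measurable_funX.
  - by move=> w _; rewrite lee_fin sqr_ge0.
  rewrite integral_cst//= probability_setT mule1 leeD2r//.
  by rewrite /c exprMn; apply: (iid_sum_sqr_le iid); rewrite ?fm1.
rewrite -(@leeD2rE _ (2 * c * c)%:E)//.
by apply: (le_trans h); rewrite -!EFinD lee_fin; lra.
Qed.

(** Supplies the truncation level [t = K * l]. The tail is made as small as the square of [s / d] so
    that [in_G_truncated_moment] applies with [eps = s / d]. *)
Lemma tail_threshold (R : realType) (a tau : R) : 0 < a -> 0 < tau ->
  exists2 K : R, 0 < K & forall d s : nat, (0 < s)%N -> (s < d)%N ->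
  let l := (ln (expR 1 * d%:R / s%:R)) `^ (1 / a) in
  [/\ 1 <= l, 2 <= K * l & expR (- (K * l / tau) `^ a) <= (s%:R / d%:R) ^+ 2].
Proof.
move=> a0 tau0; pose k : R := 2 `^ (1 / a).
have k0 : 0 < k by exact: powR_gt0.
(* As [l >= 1], the summand 2 ensures [K * l >= 2]. The summand [tau * k] makes the exponent at
   least [(k l)^a = 2 L], and [exp(-2 L) = (s / (e d))^2]. *)
exists (2 + tau * k); first by rewrite ltr_pwDl// mulr_ge0// ltW.
move=> d s s0 sd; set L := ln _; rewrite /=; set l := L `^ _.
have s0R : 0 < s%:R :> R by rewrite ltr0n.
have d0R : 0 < d%:R :> R by rewrite ltr0n (leq_ltn_trans _ sd).
have ds : 1 <= d%:R / s%:R :> R.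
  by rewrite ler_pdivlMr// mul1r ler_nat ltnW.
have LE : L = 1 + ln (d%:R / s%:R).
  rewrite /L -mulrA lnM ?posrE ?expR_gt0 ?divr_gt0//.
  by rewrite expRK.
have L1 : 1 <= L by rewrite LE lerDl ln_ge0.
have a1 : 0 <= 1 / a by rewrite divr_ge0// ltW.
have l1 : 1 <= l.
  have -> : 1 = 1 `^ (1 / a) :> R by rewrite powR1.
  by apply: ge0_ler_powR; rewrite ?nnegrE//; lra.
have tk0 : 0 < tau * k by rewrite mulr_gt0.
have tkl : 0 <= tau * k * l by rewrite mulr_ge0 ?(ltW tk0)//; lra.
split => //; first by rewrite mulrDl; lra.
have h : 2 * L <= ((2 + tau * k) * l / tau) `^ a.
  have -> : 2 * L = (k * l) `^ a.
    rewrite /k /l -powRM//; last lra.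
    by rewrite -powRrM mul1r mulVf ?gt_eqF// powRr1//; lra.
  apply: ge0_ler_powR; first exact: ltW.
  - by rewrite nnegrE mulr_ge0 ?(ltW k0)//; lra.
  - by rewrite nnegrE divr_ge0 ?(ltW tau0)// mulrDl; lra.
  - rewrite ler_pdivlMr// mulrDl [leLHS](_ : _ = tau * k * l); last by ring.
    lra.
apply: (@le_trans _ _ (expR (- (2 * L)))); first by rewrite ler_expR lerN2.
have -> : - (2 * L) = (- L) *+ 2 by rewrite mulr2n; lra.
rewrite mulr2n expRD -expr2 lerXn2r ?nnegrE ?expR_ge0 ?divr_ge0//.
rewrite expRN LE expRD lnK ?posrE ?divr_gt0// invfM invf_div.
rewrite ler_piMl ?divr_ge0// invf_le1 ?expR_gt0//.
by have := expR_ge1Dx (1 : R); lra.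
Qed.

(** * The risk bound *)

Theorem theorem3 (R : realType) (a tau : R) (ha : 0 < a) (htau : 0 < tau) :
  exists C : R, 0 < C /\
  forall (d s : nat), (1 <= s)%N -> (2 * s < d)%N ->
  forall (mu : probability (measurableTypeR R) R), in_G a tau mu ->
  forall (dT : measure_display) (T : measurableType dT) (P : probability T R)
         (xi : 'I_d -> T -> R), iid_with_law P xi mu ->
  forall (sigma : R), 0 < sigma ->
  forall (theta : 'I_d -> R), sparse s theta ->
  (\int[P]_w (((sigma_hat2 s (fun i => theta i + sigma * xi i w) - sigma ^+ 2) ^+ 2)
                 / sigma ^+ 4)%:E
     <= (C * rate a d s ^+ 2)%:E)%E.
Proof.
have [M M0 hM] := in_G_fourth_moment ha htau.
have [K K0 hK] := tail_threshold ha htau.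
(* [6 * M] adds 2 from the fluctuation of the full sum and 4 from the diagonal part of [Z]; [K ^+ 4]
   comes from [t ^+ 4]; the last term is the squared truncated mean in [Z]. *)
exists (6 * M + 16 * K ^+ 4 + 4 * (M + 2) ^+ 2); split.
  have : 0 <= K ^+ 4 by rewrite exprn_even_ge0.
  have := sqr_ge0 (M + 2); lra.
move=> d s s0 sd2 mu muG dT T P xi iid sigma sigma0 theta sp.
have sd : (s < d)%N by apply: leq_ltn_trans sd2; rewrite leq_pmull.
have [l1 t2 tailt] := hK d s s0 sd.
set l := _ `^ _ in l1 t2 tailt; set t := K * l in t2 tailt.
set rho := s%:R / d%:R in tailt.
have d0 : 0 < d%:R :> R by rewrite ltr0n (leq_ltn_trans _ sd).
have rho0 : 0 < rho by rewrite divr_gt0// ltr0n.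
have M4 := hM mu muG.
have trunc := in_G_truncated_moment muG M4 t2 rho0 tailt.
have m20 : (\int[mu]_x (x ^+ 2)%:E = 1%:E)%E by case: muG.
have [mxi _ _] := iid.
pose sq (x : R) := x ^+ 2.
pose tr (x : R) := if t ^+ 2 < x ^+ 2 then x ^+ 2 else 0.
have msq : measurable_fun setT sq by exact: measurable_funX.
have mtr : measurable_fun setT tr.
  apply: measurable_fun_ifT => //.
  exact: measurable_fun_ltr.
have sq_ge0 x : 0 <= sq x by exact: sqr_ge0.
have tr_ge0 x : 0 <= tr x by rewrite /tr; case: ifP => // _; exact: sqr_ge0.
have msqxi i : measurable_fun setT (fun w => sq (xi i w)).
  exact: (measurableT_comp msq (mxi i)).
have mtrxi i : measurable_fun setT (fun w => tr (xi i w)).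
  exact: (measurableT_comp mtr (mxi i)).
pose V w := (\sum_i sq (xi i w) - d%:R) ^+ 2.
pose Z w := (\sum_i tr (xi i w)) ^+ 2.
have mV : measurable_fun setT V.
  apply: measurable_funX; apply: measurable_funB => //.
  exact: measurable_sum.
have mZ : measurable_fun setT Z.
  by apply: measurable_funX; exact: measurable_sum.
have intV : (\int[P]_w (V w)%:E <= (d%:R * M)%:E)%E.
  have sq2 : (\int[mu]_x (sq x ^+ 2)%:E <= M%:E)%E.
    by under eq_integral do rewrite /sq -exprM.
  by have := iid_sum_variance_le iid msq sq_ge0 m20 sq2; rewrite mulr1.
have intZ : (\int[P]_w (Z w)%:E
    <= (d%:R * M + d%:R ^+ 2 * (rho * (M + 2)) ^+ 2)%:E)%E.
  (* The first moment of [tr] is bounded by [trunc]; its second moment is at most [M] because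
     [tr x ^+ 2 <= x ^+ 4]. *)
  apply: (iid_sum_sqr_le iid) => //; first by rewrite mulr_ge0 ?addr_ge0 ?ltW.
  apply: le_trans M4; apply: nneg_le_integral => x.
    by rewrite lee_fin sqr_ge0.
  rewrite lee_fin /tr; case: ifP => _; first by rewrite -exprM.
  by rewrite expr0n exprn_even_ge0.
pose q := 16 * (s%:R * t ^+ 2) ^+ 2.
have q0 : 0 <= q by rewrite mulr_ge0 ?sqr_ge0.
apply: (@le_trans _ _ (\int[P]_w ((d%:R ^- 2)%:E *
    (2%:E * (V w)%:E + q%:E + 4%:E * (Z w)%:E)))%E).
  apply: nneg_le_integral => w.
    by rewrite lee_fin divr_ge0 ?sqr_ge0// exprn_even_ge0.
  by rewrite -!EFinM lee_fin; exact: sigma_hat2_error_le.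
have V0 w : (0 <= 2%:E * (V w)%:E)%E by rewrite -EFinM lee_fin mulr_ge0 ?sqr_ge0.
have Z0 w : (0 <= 4%:E * (Z w)%:E)%E by rewrite -EFinM lee_fin mulr_ge0 ?sqr_ge0.
have mEV : measurable_fun setT (fun w => 2%:E * (V w)%:E)%E.
  by apply: measurable_funeM; exact/measurable_EFinP.
have mEZ : measurable_fun setT (fun w => 4%:E * (Z w)%:E)%E.
  by apply: measurable_funeM; exact/measurable_EFinP.
have mEVq : measurable_fun setT (fun w => 2%:E * (V w)%:E + q%:E)%E.
  exact: emeasurable_funD.
have Vq0 w : (0 <= 2%:E * (V w)%:E + q%:E)%E by rewrite adde_ge0// lee_fin.
have di0 : 0 <= d%:R ^- 2 :> R by rewrite invr_ge0 exprn_ge0// ltW.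
rewrite ge0_integralZl_EFin//; first last.
- exact: emeasurable_funD.
- by move=> w _; rewrite adde_ge0.
rewrite ge0_integralD// ge0_integralD//.
rewrite !ge0_integralZl_EFin//; first last.
- exact/measurable_EFinP.
- by move=> w _; rewrite lee_fin sqr_ge0.
- exact/measurable_EFinP.
- by move=> w _; rewrite lee_fin sqr_ge0.
rewrite integral_cst//= probability_setT mule1.
apply: (@le_trans _ _ ((d%:R ^- 2) * (2 * (d%:R * M) + q
    + 4 * (d%:R * M + d%:R ^+ 2 * (rho * (M + 2)) ^+ 2)))%:E).
  rewrite [leRHS]EFinM lee_wpmul2l ?lee_fin// [leRHS]EFinD.
  apply: leeD; last by rewrite [leRHS]EFinM lee_wpmul2l ?lee_fin.
  by rewrite [leRHS]EFinD leeD2r// [leRHS]EFinM lee_wpmul2l ?lee_fin.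
rewrite lee_fin.
(* The bound splits into multiples of [1 / d], [(rho l^2)^2] and [rho^2]. The first two are the
   squares of the arguments of the maximum in [rate]; the third is dominated by the second since
   [l >= 1]. *)
have -> : d%:R ^- 2 * (2 * (d%:R * M) + q
      + 4 * (d%:R * M + d%:R ^+ 2 * (rho * (M + 2)) ^+ 2)) =
    6 * M * d%:R^-1 + 16 * K ^+ 4 * (rho * l ^+ 2) ^+ 2
      + 4 * (M + 2) ^+ 2 * rho ^+ 2.
  by rewrite /q /t /rho; field; rewrite gt_eqF.
have r1 : d%:R^-1 <= rate a d s ^+ 2.
  rewrite -[X in X^-1](sqr_sqrtr (ltW d0)) -exprVn.
  rewrite lerXn2r ?nnegrE ?invr_ge0 ?sqrtr_ge0// /rate le_max ?lexx//.
  by rewrite invr_ge0 sqrtr_ge0.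
have r2 : (rho * l ^+ 2) ^+ 2 <= rate a d s ^+ 2.
  have lE : l ^+ 2 = (ln (expR 1 * d%:R / s%:R)) `^ (2 / a).
    rewrite -powR_mulrn ?powR_ge0// -powRrM; congr (_ `^ _).
    by field; rewrite gt_eqF.
  have h : rho * l ^+ 2 <= rate a d s by rewrite /rate lE le_max lexx orbT.
  have h0 : 0 <= rho * l ^+ 2 by rewrite mulr_ge0 ?sqr_ge0// ltW.
  by rewrite lerXn2r ?nnegrE// (le_trans h0).
have r3 : rho ^+ 2 <= rate a d s ^+ 2.
  have h : rho <= rho * l ^+ 2 by rewrite ler_pMr// exprn_ege1.
  apply: le_trans r2; rewrite lerXn2r ?nnegrE ?(ltW rho0)//.
  exact: (le_trans (ltW rho0)).
rewrite [leRHS]mulrDl [X in _ <= X + _]mulrDl.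
apply: lerD; [apply: lerD|]; apply: ler_wpM2l => //.
- by rewrite mulr_ge0// ltW.
- by rewrite mulr_ge0// exprn_even_ge0.
- by rewrite mulr_ge0// sqr_ge0.
Qed.
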